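(* Let $\bar\epsilon\in\operatorname{int}(\mathcal E)$. Assume that for every sequence $\{\epsilon_k\}\to\bar\epsilon$ (with $\epsilon_k\in\operatorname{int}(\mathcal E)$) there exists a sequence of optimal solutions $\{(X(\epsilon_k),y(\epsilon_k),S(\epsilon_k))\}$, with $(X(\epsilon_k),y(\epsilon_k),S(\epsilon_k))\in\mathcal P^*(\epsilon_k)\times\mathcal D^*(\epsilon_k)$, converging to $(X^*(\bar\epsilon),y^*(\bar\epsilon),S^*(\bar\epsilon))$, where $(X^*(\bar\epsilon),y^*(\bar\epsilon),S^*(\bar\epsilon))\in\mathcal P^*(\bar\epsilon)\times\mathcal D^*(\bar\epsilon)$ is a strictly complementary solution. Then $\bar\epsilon$ belongs to a nonlinearity interval.
   Context: Setting. $\mathbb S^n$ is the space of real symmetric $n\times n$ matrices with inner product $\langle C,X\rangle=\operatorname{trace}(CX)$; $X\succeq0$ ($\succ0$) means positive semidefinite (definite). Given $C,\bar C,A^1,\dots,A^m\in\mathbb S^n$ and $b\in\mathbb R^m$, consider for $\epsilon\in\mathbb R$ $$(\mathrm P_\epsilon)\ \min\{\langle C+\epsilon\bar C,X\rangle : \langle A^i,X\rangle=b_i,\ i=1,\dots,m,\ X\succeq0\},$$ $$(\mathrm D_\epsilon)\ \max\{b^Ty : \textstyle\sum_{i=1}^m y_iA^i+S=C+\epsilon\bar C,\ S\succeq0,\ y\in\mathbb R^m\}.$$ Standing assumptions: $A^1,\dots,A^m$ are linearly independent, and at $\epsilon=0$ there is a feasible $(X,y,S)$ of $(\mathrm P_0),(\mathrm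 D_0)$ with $X\succ0$, $S\succ0$. $v(\epsilon)$ is the optimal value of $(\mathrm P_\epsilon)$ and $\mathcal E=\{\epsilon: v(\epsilon)>-\infty\}$, which is a closed, possibly unbounded, interval with $0$ in its interior. For $\epsilon\in\operatorname{int}(\mathcal E)$ strong duality holds and the sets of optimal solutions $\mathcal P^*(\epsilon)$ (of $X$) and $\mathcal D^*(\epsilon)$ (of $(y,S)$) are nonempty and compact. An optimal solution $(X,y,S)\in\mathcal P^*(\epsilon)\times\mathcal D^*(\epsilon)$ satisfies $XS=0$. It is maximally complementary if $X\in\operatorname{ri}(\mathcal P^*(\epsilon))$ and $(y,S)\in\operatorname{ri}(\mathcal D^*(\epsilon))$ (relative interiors), and strictly complementary if $X+S\succ0$. Optimal partition: for a maximally complementary solution $(X^*(\epsilon),y^*(\epsilon),S^*(\epsilon))$, let $\mathcal B(\epsilon)$ be the column space of $X^*(\epsilon)$, $\mathcal N(\epsilon)$ the column space of $S^*(\epsilon)$, $\mathcal T(\epsilon)=(\mathcal B(\epsilon)+\mathcal N(\epsilon))^\perp$, and $\pi(\epsilon)=(\mathcal B(\epsilon),\mathcal T(\epsilon),\mathcal N(\epsilon))$ (independent of the choice of maximally complementary solution). A nonlinearity interval is a non-singleton open, possibly unbounded, subinterval $\mathcal I_{\mathrm{non}}\subseteq\operatorname{int}(\mathcal E)$ of maximal length such that $\dim\mathcal B(\epsilon')=\dim\mathcal B(\epsilon'')$ and $\dim\mathcal N(\epsilon')=\dim\mathcal N(\epsilon'')$ for all $\epsilon',\epsilon''\in\mathcal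 I_{\mathrm{non}}$, while $\pi(\epsilon)$ varies with $\epsilon$.
   Formalization: Adds the hypothesis that ε̄ lies in no maximal open interval of constant dim B and dim N on which π is constant; without it the claim fails, e.g. n=m=1, A=b=1, C=C̄=0, where X=1, S=0 is strictly complementary for every ε but π never varies. *)

(* Defs.v *)
From mathcomp Require Export all_boot all_order all_algebra.
From mathcomp Require Export all_classical all_reals all_analysis.

Set Implicit Arguments.
Unset Strict Implicit.
Unset Printing Implicit Defensive.

Import Order.TTheory GRing.Theory Num.Theory.
Import numFieldNormedType.Exports.

Local Open Scope classical_set_scope.
Local Open Scope ring_scope.

Definition symmetric (R : realType) (n : nat) (M : 'M[R]_n) : Prop := M^T = M.

Definition psd (R : realType) (n : nat) (M : 'M[R]_n) : Prop :=
  symmetric M /\ forall x : 'cV[R]_n, 0 <= (x^T *m M *m x) 0 0.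

Definition pd (R : realType) (n : nat) (M : 'M[R]_n) : Prop :=
  symmetric M /\ forall x : 'cV[R]_n, x != 0 -> 0 < (x^T *m M *m x) 0 0.

Definition mxinner (R : realType) (n : nat) (M N : 'M[R]_n) : R :=
  \tr (M *m N).

(* Data C, \bar C, A^1, ..., A^m, b of the parametric problem. *)
Record parametric_sdp (R : realType) (n m : nat) := ParametricSDP {
  cost : 'M[R]_n ;
  cost_dir : 'M[R]_n ;
  constr : 'I_m -> 'M[R]_n ;
  rhs : 'cV[R]_m
}.

Definition cost_at (R : realType) (n m : nat) (P : parametric_sdp R n m)
    (eps : R) : 'M[R]_n :=
  cost P + eps *: cost_dir P.

Definition dual_obj (R : realType) (n m : nat) (P : parametric_sdp R n m)
    (y : 'cV[R]_m) : R :=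
  \sum_(i < m) rhs P i 0 * y i 0.

(* The primal feasible set does not depend on eps. *)
Definition primal_feasible (R : realType) (n m : nat)
    (P : parametric_sdp R n m) : set 'M[R]_n :=
  [set X | (forall i, mxinner (constr P i) X = rhs P i 0) /\ psd X].

Definition dual_feasible (R : realType) (n m : nat)
    (P : parametric_sdp R n m) (eps : R) : set ('cV[R]_m * 'M[R]_n) :=
  [set yS : 'cV[R]_m * 'M[R]_n |
     (\sum_(i < m) yS.1 i 0 *: constr P i) + yS.2 = cost_at P eps
     /\ psd yS.2].

Definition standing_assumptions (R : realType) (n m : nat)
    (P : parametric_sdp R n m) : Prop :=
  [/\ [/\ symmetric (cost P), symmetric (cost_dir P) &
          forall i, symmetric (constr P i)],
      free [seq constr P i | i <- enum 'I_m] &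
      exists (X : 'M[R]_n) (y : 'cV[R]_m) (S : 'M[R]_n),
        [/\ primal_feasible P X, dual_feasible P 0 (y, S), pd X & pd S]].

Definition optimal_value (R : realType) (n m : nat)
    (P : parametric_sdp R n m) (eps : R) : \bar R :=
  ereal_inf [set (mxinner (cost_at P eps) X)%:E | X in primal_feasible P].

Definition bounded_params (R : realType) (n m : nat)
    (P : parametric_sdp R n m) : set R :=
  [set eps | (-oo < optimal_value P eps)%E].

Definition primal_optimal (R : realType) (n m : nat)
    (P : parametric_sdp R n m) (eps : R) : set 'M[R]_n :=
  [set X | primal_feasible P X /\
           forall X', primal_feasible P X' ->
             mxinner (cost_at P eps) X <= mxinner (cost_at P eps) X'].

Definition dual_optimal (R : realType) (n m : nat)
    (P : parametric_sdp R n m) (eps : R) : set ('cV[R]_m * 'M[R]_n) :=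
  [set yS : 'cV[R]_m * 'M[R]_n | dual_feasible P eps yS /\
            forall yS', dual_feasible P eps yS' ->
              dual_obj P yS'.1 <= dual_obj P yS.1].

Definition affine_hull (R : realType) (V : lmodType R) (A : set V) : set V :=
  [set x | exists (k : nat) (t : 'I_k -> R) (a : 'I_k -> V),
      [/\ forall i, A (a i), \sum_(i < k) t i = 1 &
          x = \sum_(i < k) t i *: a i]].

Definition primal_relint (R : realType) (n : nat) (A : set 'M[R]_n) :
    set 'M[R]_n :=
  [set X | A X /\ \forall X' \near X, affine_hull A X' -> A X'].

Definition dual_relint (R : realType) (n m : nat)
    (A : set ('cV[R]_m * 'M[R]_n)) : set ('cV[R]_m * 'M[R]_n) :=
  [set yS | A yS /\ \forall yS' \near yS, affine_hull A yS' -> A yS'].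

Definition maximally_complementary (R : realType) (n m : nat)
    (P : parametric_sdp R n m) (eps : R)
    (X : 'M[R]_n) (y : 'cV[R]_m) (S : 'M[R]_n) : Prop :=
  primal_relint (primal_optimal P eps) X /\
  dual_relint (dual_optimal P eps) (y, S).

Definition strictly_complementary (R : realType) (n m : nat)
    (P : parametric_sdp R n m) (eps : R)
    (X : 'M[R]_n) (y : 'cV[R]_m) (S : 'M[R]_n) : Prop :=
  [/\ primal_optimal P eps X, dual_optimal P eps (y, S) & pd (X + S)].

Definition column_space (R : realType) (n : nat) (M : 'M[R]_n) :
    {vspace 'cV[R]_n} :=
  limg (linfun (mulmx M : 'cV[R]_n -> 'cV[R]_n)).

Definition orthogonal_complement (R : realType) (n : nat)
    (U : {vspace 'cV[R]_n}) : {vspace 'cV[R]_n} :=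
  (\bigcap_(u <- vbasis U)
     lker (linfun (mulmx u^T : 'cV[R]_n -> 'cV[R]_1)))%VS.

Record partition3 (R : realType) (n : nat) := Partition3 {
  part_B : {vspace 'cV[R]_n} ;
  part_T : {vspace 'cV[R]_n} ;
  part_N : {vspace 'cV[R]_n}
}.

Definition partition_of (R : realType) (n : nat) (X S : 'M[R]_n) :
    partition3 R n :=
  let B := column_space X in
  let N := column_space S in
  Partition3 B (orthogonal_complement (B + N)%VS) N.

(* pi(eps) as a relation: p is induced by some maximally complementary
   solution.  For eps interior to bounded_params there is exactly one such p. *)
Definition is_optimal_partition (R : realType) (n m : nat)
    (P : parametric_sdp R n m) (eps : R) (p : partition3 R n) : Prop :=
  exists (X : 'M[R]_n) (y : 'cV[R]_m) (S : 'M[R]_n),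
    maximally_complementary P eps X y S /\ p = partition_of X S.

Definition constant_dims (R : realType) (n m : nat)
    (P : parametric_sdp R n m) (I : set R) : Prop :=
  forall e1 e2 p1 p2, I e1 -> I e2 ->
    is_optimal_partition P e1 p1 -> is_optimal_partition P e2 p2 ->
    \dim (part_B p1) = \dim (part_B p2) /\ \dim (part_N p1) = \dim (part_N p2).

Definition partition_varies (R : realType) (n m : nat)
    (P : parametric_sdp R n m) (I : set R) : Prop :=
  exists e1 e2 p1 p2,
    [/\ I e1, I e2, is_optimal_partition P e1 p1,
        is_optimal_partition P e2 p2 & p1 <> p2].

Definition constant_dims_interval (R : realType) (n m : nat)
    (P : parametric_sdp R n m) (I : set R) : Prop :=
  [/\ open I, is_interval I, (exists e1 e2, [/\ I e1, I e2 & e1 != e2]),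
      I `<=` (bounded_params P)° & constant_dims P I].

(* "Of maximal length" is maximality for inclusion, since intervals may be
   unbounded.  Variation of the partition passes to larger intervals, so it need
   not be required of the competitor J. *)
Definition maximal_constant_dims_interval (R : realType) (n m : nat)
    (P : parametric_sdp R n m) (I : set R) : Prop :=
  constant_dims_interval P I /\
  forall J, constant_dims_interval P J -> I `<=` J -> J = I.

Definition nonlinearity_interval (R : realType) (n m : nat)
    (P : parametric_sdp R n m) (I : set R) : Prop :=
  maximal_constant_dims_interval P I /\ partition_varies P I.

(* The complementary case, in which the optimal partition does not depend on
   the parameter, e.g. everywhere when \bar C = 0. *)
Definition constant_partition_interval (R : realType) (n m : nat)
    (P : parametric_sdp R n m) (I : set R) : Prop :=
  maximal_constant_dims_interval P I /\ ~ partition_varies P I.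

(* Main.v *)
(* Eliminating the affine constraints one at a time, each by a scalar slope
   argument based at a positive definite feasible matrix, gives a dual feasible
   point matching the primal optimal value; hence X S = 0 for all optimal X and
   (y, S).  Positive definiteness being an open condition, if X_k, S_k converge to
   a strictly complementary pair (X, S), then eventually X_k + S_k, X_k + S and
   X + S_k are positive definite.  The first makes (X_k, S_k) strictly
   complementary, the other two bound the ranks of X_k and S_k below by those of X
   and S, and rank X_k + rank S_k = n forces equality.  As the relative interiors
   of the optimal sets inherit these ranks, the dimensions of the partition are
   constant near ebar. *)
Require Import Defs.
From mathcomp Require Import all_boot all_order all_algebra.
From mathcomp Require Import all_classical all_reals all_analysis.
From mathcomp Require Import ring lra zify.
Import Order.TTheory GRing.Theory Num.Theory.
Import numFieldNormedType.Exports.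
Local Open Scope classical_set_scope.
Local Open Scope ring_scope.

(** * Positive semidefinite matrices *)

(** With [M = 1%:M] this is the Euclidean inner product, so the same rules serve for quadratic forms
    and for norms of vectors. *)
Definition bform {R : realType} {n : nat} (M : 'M[R]_n) (x y : 'cV[R]_n) : R :=
  (x^T *m M *m y) 0 0.

Lemma bformDl {R : realType} {n : nat} (M : 'M[R]_n) x y z :
  bform M (x + y) z = bform M x z + bform M y z.
Proof. by rewrite /bform raddfD /= !mulmxDl mxE. Qed.

Lemma bformDr {R : realType} {n : nat} (M : 'M[R]_n) x y z :
  bform M z (x + y) = bform M z x + bform M z y.
Proof. by rewrite /bform !mulmxDr mxE. Qed.

Lemma bformZl {R : realType} {n : nat} (M : 'M[R]_n) a x y :
  bform M (a *: x) y = a * bform M x y.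
Proof. by rewrite /bform linearZ /= -!scalemxAl mxE. Qed.

Lemma bformZr {R : realType} {n : nat} (M : 'M[R]_n) a x y :
  bform M x (a *: y) = a * bform M x y.
Proof. by rewrite /bform -!scalemxAr mxE. Qed.

Lemma bform_addmx {R : realType} {n : nat} (M N : 'M[R]_n) x y :
  bform (M + N) x y = bform M x y + bform N x y.
Proof. by rewrite /bform mulmxDr mulmxDl mxE. Qed.

Lemma bform_scalemx {R : realType} {n : nat} a (M : 'M[R]_n) x y :
  bform (a *: M) x y = a * bform M x y.
Proof. by rewrite /bform -scalemxAr -scalemxAl mxE. Qed.

Lemma bformC {R : realType} {n : nat} {M : 'M[R]_n} x y :
  Defs.symmetric M -> bform M x y = bform M y x.
Proof.
move=> sM; rewrite /bform -[in LHS](trmxK (_ *m y)) [LHS]mxE.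
by rewrite !trmx_mul trmxK sM mulmxA.
Qed.

Lemma bform_mulmxr {R : realType} {n : nat} (M : 'M[R]_n) x y :
  bform M x y = bform 1%:M x (M *m y).
Proof. by rewrite /bform mulmx1 mulmxA. Qed.

Lemma bform1_eq0 {R : realType} {n : nat} (x : 'cV[R]_n) :
  bform 1%:M x x = 0 -> x = 0.
Proof.
rewrite /bform mulmx1 mxE => /eqP.
rewrite psumr_eq0 => [/allP h|i _]; last by rewrite mxE -expr2 sqr_ge0.
apply/colP => i; rewrite !mxE; apply/eqP.
by have := h i (mem_index_enum _); rewrite mxE mulf_eq0 orbb.
Qed.

Lemma symmetricD {R : realType} {n : nat} {M N : 'M[R]_n} :
  Defs.symmetric M -> Defs.symmetric N -> Defs.symmetric (M + N).
Proof. by rewrite /Defs.symmetric raddfD /= => -> ->. Qed.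

Lemma symmetricZ {R : realType} {n : nat} a {M : 'M[R]_n} :
  Defs.symmetric M -> Defs.symmetric (a *: M).
Proof. by rewrite /Defs.symmetric linearZ /= => ->. Qed.

Lemma symmetric_sum {R : realType} {n : nat} (I : finType) (F : I -> 'M[R]_n) :
  (forall i, Defs.symmetric (F i)) -> Defs.symmetric (\sum_i F i).
Proof.
by move=> h; rewrite /Defs.symmetric raddf_sum; apply: eq_bigr => i _; exact: h.
Qed.

Lemma psdD {R : realType} {n : nat} {M N : 'M[R]_n} :
  psd M -> psd N -> psd (M + N).
Proof.
move=> [sM pM] [sN pN]; split; first exact: symmetricD.
by move=> x; rewrite -/(bform _ _ _) bform_addmx addr_ge0// ?pM ?pN.
Qed.

Lemma psdZ {R : realType} {n : nat} a {M : 'M[R]_n} :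
  0 <= a -> psd M -> psd (a *: M).
Proof.
move=> a0 [sM pM]; split; first exact: symmetricZ.
by move=> x; rewrite -/(bform _ _ _) bform_scalemx mulr_ge0// pM.
Qed.

Lemma pd_psd {R : realType} {n : nat} {M : 'M[R]_n} : pd M -> psd M.
Proof.
move=> [sM pM]; split=> // x; have [->|x0] := eqVneq x 0; last exact/ltW/pM.
by rewrite mulmx0 mxE.
Qed.

Lemma psd_rank1 {R : realType} {n : nat} (v : 'cV[R]_n) : psd (v *m v^T).
Proof.
split=> [|x]; first by rewrite /Defs.symmetric trmx_mul trmxK.
rewrite !mulmxA -mulmxA mxE big_ord1.
have -> : (v^T *m x) 0 0 = (x^T *m v) 0 0.
  by rewrite -[in LHS](trmxK (_ *m x)) mxE trmx_mul trmxK.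
by rewrite -expr2 sqr_ge0.
Qed.

(** The quadratic polynomial [t |-> bform M (x + t *: y) (x + t *: y)] is nonnegative, which bounds
    its discriminant. *)
Lemma psd_cauchy {R : realType} {n : nat} {M : 'M[R]_n} x y : psd M ->
  bform M x y ^+ 2 <= bform M x x * bform M y y.
Proof.
move=> [sM pM].
have q t : 0 <= bform M x x + 2 * bform M x y * t + bform M y y * t ^+ 2.
  have := pM (x + t *: y); rewrite -/(bform _ _ _) !bformDl !bformDr.
  rewrite !bformZl !bformZr (bformC y x sM); congr (0 <= _); ring.
have [a0 c0] : 0 <= bform M x x /\ 0 <= bform M y y by split; exact: pM.
move: (bform M x x) (bform M x y) (bform M y y) q a0 c0 => a b c q a0 c0.
have [cE|cN] := eqVneq c 0.
  have [->|bN] := eqVneq b 0; first by rewrite expr0n /= mulr_ge0.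
  (* With [c = 0] the polynomial is affine in [t]; it would take the value -1 here. *)
  have := q (- (a + 1) / (2 * b)); rewrite cE.
  have -> : 2 * b * (- (a + 1) / (2 * b)) = - (a + 1).
    by field.
  lra.
have cp : 0 < c by rewrite lt_def cN.
(* The minimizer of the quadratic. *)
have := q (- b / c).
have -> : a + 2 * b * (- b / c) + c * (- b / c) ^+ 2 = (a * c - b ^+ 2) / c.
  by field.
by rewrite pmulr_lge0 ?invr_gt0// subr_ge0.
Qed.

(** Cauchy-Schwarz for the vectors [M *m x] and [x]: the left side is the square of the squared
    Euclidean norm of [M *m x]. *)
Lemma psd_ker {R : realType} {n : nat} {M : 'M[R]_n} x :
  psd M -> bform M x x = 0 -> M *m x = 0.
Proof.
move=> pM x0; apply: bform1_eq0; rewrite -bform_mulmxr.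
have := psd_cauchy (M *m x) x pM; rewrite x0 mulr0 => h.
by apply/eqP; rewrite -sqrf_eq0 eq_le h sqr_ge0.
Qed.

(* Cholesky: the first [k] rows and columns are cleared one at a time. *)
Lemma psd_partial_cholesky {R : realType} {n : nat} {M : 'M[R]_n} k : psd M ->
  exists (v : nat -> 'cV[R]_n) (N : 'M[R]_n),
    [/\ psd N, (forall i j : 'I_n, (j < k)%N -> N i j = 0) &
        M = \sum_(i < k) v i *m (v i)^T + N].
Proof.
move=> pM; elim: k => [|k [v [N [pN N0 MN]]]].
  by exists (fun=> 0), M; split=> //; rewrite big_ord0 add0r.
have [kn|nk] := ltnP k n; last first.
  exists (fun i => if (i < k)%N then v i else 0), N; split=> //.
    by move=> i j _; apply: N0; exact: leq_trans (ltn_ord j) nk.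
  rewrite big_ord_recr /= ltnn trmx0 mulmx0 addr0 MN; congr (_ + _).
  by apply: eq_bigr => i _; rewrite ltn_ord.
pose o := Ordinal kn.
pose e : 'cV[R]_n := delta_mx o 0.
have Ne i : (N *m e) i 0 = N i o.
  rewrite mxE (bigD1 o)//= big1 ?addr0 => [|j jo].
    by rewrite mxE !eqxx mulr1.
  by rewrite mxE (negbTE jo) mulr0.
have be x : bform N e x = (N *m x) o 0.
  rewrite /bform -mulmxA mxE (bigD1 o)//= big1 ?addr0 => [|j jo].
    by rewrite !mxE !eqxx mul1r.
  by rewrite !mxE (negbTE jo) mul0r.
have d0 : 0 <= N o o by rewrite -Ne -be; exact: pN.2.
have sN i j : N i j = N j i by rewrite -[in LHS]pN.1 mxE.
(* A zero pivot means by [psd_ker] that the whole column is zero already, so the vector 0 is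
   recorded for this step. *)
have [dE|dN] := eqVneq (N o o) 0.
  have Ne0 : N *m e = 0 by apply: psd_ker => //; rewrite be Ne.
  exists (fun i => if (i < k)%N then v i else 0), N; split=> //.
    move=> i j; rewrite ltnS leq_eqVlt => /orP[/eqP jk|]; last exact: N0.
    have -> : j = o by exact/val_inj.
    by rewrite -Ne Ne0 mxE.
  rewrite big_ord_recr /= ltnn trmx0 mulmx0 addr0 MN; congr (_ + _).
  by apply: eq_bigr => i _; rewrite ltn_ord.
have dp : 0 < N o o by rewrite lt_def dN.
pose s := Num.sqrt (N o o).
have s0 : s != 0 by rewrite gt_eqF// sqrtr_gt0.
have sE : N o o = s ^+ 2 by rewrite sqr_sqrtr.
(* [w *m w^T] agrees with [N] on column [o], and [N - w *m w^T] is the Schur complement; it stays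
   positive semidefinite by Cauchy-Schwarz for [x] and [e]. *)
pose w := s^-1 *: (N *m e).
have wi i : w i 0 = s^-1 * N i o by rewrite mxE Ne.
have wE i j : (w *m w^T) i j = N i o * N j o / N o o.
  by rewrite mxE big_ord1 [w^T _ _]mxE !wi sE; field.
exists (fun i => if (i < k)%N then v i else w), (N - w *m w^T); split.
- split=> [|x].
    by rewrite /Defs.symmetric raddfB /= pN.1 trmx_mul trmxK.
  have ww : bform (w *m w^T) x x = bform N x e ^+ 2 / N o o.
    rewrite /bform !mulmxA -mulmxA mxE big_ord1.
    have -> : (w^T *m x) 0 0 = (x^T *m w) 0 0.
      by rewrite -[in LHS](trmxK (_ *m x)) mxE trmx_mul trmxK.
    rewrite -scalemxAr mulmxA mxE -/(bform _ _ _) sE.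
    by field.
  rewrite -/(bform _ x x) bform_addmx -scaleN1r bform_scalemx ww mulN1r subr_ge0.
  rewrite ler_pdivrMr//; have := psd_cauchy x e pN.
  by rewrite (be e) Ne.
- move=> i j; rewrite ltnS leq_eqVlt => /orP[/eqP jk|jk].
    have -> : j = o by exact/val_inj.
    by rewrite mxE [X in _ + X]mxE wE mulfK// subrr.
  by rewrite mxE [X in _ + X]mxE wE (N0 _ _ jk) (sN j o) (N0 _ _ jk) mulr0 mul0r subrr.
- rewrite big_ord_recr /= ltnn -addrA (addrC (w *m _)) subrK MN; congr (_ + _).
  by apply: eq_bigr => i _; rewrite ltn_ord.
Qed.

Lemma psd_sum_rank1 {R : realType} {n : nat} {M : 'M[R]_n} : psd M ->
  exists v : 'I_n -> 'cV[R]_n, M = \sum_i v i *m (v i)^T.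
Proof.
move=> /(psd_partial_cholesky n)[v [N [_ N0 ->]]]; exists v.
suff -> : N = 0 by rewrite addr0.
by apply/matrixP => i j; rewrite N0 ?mxE.
Qed.

Lemma mxinner_rank1 {R : realType} {n : nat} (M : 'M[R]_n) v :
  mxinner M (v *m v^T) = bform M v v.
Proof. by rewrite /mxinner mulmxA mxtrace_mulC mulmxA trace_mx11. Qed.

Lemma mxinner_sumr {R : realType} {n : nat} (I : finType) (M : 'M[R]_n) F :
  mxinner M (\sum_(i : I) F i) = \sum_i mxinner M (F i).
Proof. by rewrite /mxinner mulmx_sumr raddf_sum. Qed.

Lemma mxinnerC {R : realType} {n : nat} (M N : 'M[R]_n) :
  mxinner M N = mxinner N M.
Proof. exact: mxtrace_mulC. Qed.

(** Splitting [N] into rank-one terms turns the trace into a sum of values of the quadratic form of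
    [M]. *)
Lemma mxinner_ge0 {R : realType} {n : nat} {M N : 'M[R]_n} :
  psd M -> psd N -> 0 <= mxinner M N.
Proof.
move=> pM /psd_sum_rank1[v ->]; rewrite mxinner_sumr sumr_ge0// => i _.
by rewrite mxinner_rank1; exact: pM.2.
Qed.

(** In the same splitting every summand vanishes, so [psd_ker] puts each rank-one vector of [N] in
    the kernel of [M]. *)
Lemma mxinner_eq0 {R : realType} {n : nat} {M N : 'M[R]_n} :
  psd M -> psd N -> mxinner M N = 0 -> M *m N = 0.
Proof.
move=> pM /psd_sum_rank1[v ->]; rewrite mxinner_sumr => /eqP.
rewrite psumr_eq0 => [/allP h|i _]; last first.
  by rewrite mxinner_rank1; exact: pM.2.
rewrite mulmx_sumr big1// => i _; rewrite mulmxA psd_ker ?mul0mx//.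
by have := h i (mem_index_enum _); rewrite mxinner_rank1 => /eqP.
Qed.

(** * Openness of positive definiteness and Lagrange multipliers *)

Lemma normr_entry {R : realType} {m n : nat} (M : 'M[R]_(m, n)) i j :
  `|M i j| <= `|M|.
Proof.
by rewrite [leRHS]/Num.norm /= mx_normrE; apply/bigmax_geP; right; exists (i, j).
Qed.

Lemma bform_norm_le {R : realType} {n : nat} (M : 'M[R]_n) (x : 'rV[R]_n) :
  `|x| = 1 -> `|bform M x^T x^T| <= (n * n)%:R * `|M|.
Proof.
move=> x1; rewrite /bform mxE trmxK.
apply: (le_trans (ler_norm_sum _ _ _)).
have -> : (n * n)%:R * `|M| = \sum_(j < n) \sum_(i < n) `|M|.
  by rewrite !sumr_const !card_ord -mulrnA mulr_natl.
apply: ler_sum => j _; rewrite [x^T _ _]mxE mxE normrM.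
have xj i : `|x 0 i| <= 1 by rewrite -x1 normr_entry.
apply: (@le_trans _ _ `|\sum_i x 0 i * M i j|).
  by rewrite -[leRHS]mulr1 ler_wpM2l.
apply: (le_trans (ler_norm_sum _ _ _)); apply: ler_sum => i _.
rewrite normrM -[leRHS]mul1r ler_pM//; exact: normr_entry.
Qed.

(** The form is continuous and attains its minimum on the compact unit sphere of the sup norm. Row
    vectors are used to match [EVT_min_rV]. *)
Lemma pd_coercive {R : realType} {n : nat} {M : 'M[R]_n} : pd M ->
  exists2 c, 0 < c & forall x : 'rV[R]_n, `|x| = 1 -> c <= bform M x^T x^T.
Proof.
(* In dimension 0 the sphere is empty and any constant will do. *)
case: n M => [|n] M [sM pM].
  exists 1 => // x; rewrite (_ : x = 0) ?normr0; last by apply/rowP => -[].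
  by move/esym/eqP; rewrite oner_eq0.
pose A := [set x : 'rV[R]_n.+1 | `|x| = 1].
have cA : compact A.
  apply: bounded_closed_compact.
    by exists 1; split=> // y y1 x /= ->; exact: ltW.
  apply: (@closed_comp _ _ (fun x : 'rV[R]_n.+1 => `|x|) [set 1]) => [x _|].
    exact: norm_continuous.
  exact: closed_eq.
have A0 : A !=set0.
  pose x : 'rV[R]_n.+1 := const_mx 1.
  have x0 : `|x| != 0.
    rewrite normr_eq0; apply/eqP => /rowP/(_ 0); rewrite !mxE => /eqP.
    by rewrite oner_eq0.
  by exists (`|x|^-1 *: x); rewrite /A /= normrZ normfV normr_id mulVf.
have [|c cAc cmin] := EVT_min_rV (f := fun x => bform M x^T x^T) A0 cA.
  apply: continuous_subspaceT.
  have -> : (fun x : 'rV[R]_n.+1 => bform M x^T x^T) =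
      (fun x => \sum_j (\sum_i x 0 i * M i j) * x 0 j).
    apply/funext => y; rewrite /bform mxE trmxK; apply: eq_bigr => j _.
    by rewrite [y^T _ _]mxE mxE.
  apply: continuous_big => [|j _ x]; first exact: add_continuous.
  apply: (@continuousM _ _ (fun x : 'rV[R]_n.+1 => \sum_i x 0 i * M i j)).
    move: x; apply: continuous_big => [|i _ x]; first exact: add_continuous.
    apply: (@continuousM _ _ (fun x : 'rV[R]_n.+1 => x 0 i)).
      exact: coord_continuous.
    exact: cst_continuous.
  exact: coord_continuous.
exists (bform M c^T c^T) => [|x x1]; last by apply: cmin; rewrite inE.
apply: pM; apply/eqP => c0; move: cAc; rewrite inE /A /= -[c]trmxK c0 trmx0.
by rewrite normr0 => /eqP; rewrite eq_sym oner_eq0.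
Qed.

Lemma pd_open {R : realType} {n : nat} {M : 'M[R]_n} : pd M ->
  exists2 r, 0 < r &
    forall N, Defs.symmetric N -> `|N - M| < r -> pd N.
Proof.
(* On unit vectors the perturbation changes the form by at most [n * n] times its norm, which this
   radius keeps below [c]; the successor avoids division by zero. *)
move=> /pd_coercive[c c0 cM]; exists (c / (n * n).+1%:R); first by rewrite divr_gt0.
move=> N sN NM; split=> // x x0; rewrite -/(bform _ _ _).
have xT0 : `|x^T| != 0 by rewrite normr_eq0 trmx_eq0.
pose z := `|x^T|^-1 *: x^T.
have z1 : `|z| = 1 by rewrite normrZ normfV normr_id mulVf.
have -> : x = `|x^T| *: z^T by rewrite linearZ /= trmxK scalerA mulfV// scale1r.
rewrite bformZl bformZr mulrA -expr2 mulr_gt0 ?exprn_even_gt0//.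
rewrite -[N](subrKC M) bform_addmx.
have := cM _ z1; have := bform_norm_le (N - M) _ z1; rewrite ler_norml => /andP[+ _].
have : (n * n)%:R * `|N - M| < c.
  move: NM; rewrite ltr_pdivlMr// => NM; apply: le_lt_trans NM.
  by rewrite mulrC ler_wpM2l// ler_nat.
lra.
Qed.

Lemma pd_add_small {R : realType} {n : nat} {M N : 'M[R]_n} :
  pd M -> Defs.symmetric N -> exists2 d, 0 < d & pd (M + d *: N).
Proof.
move=> pM sN; have [r r0 pr] := pd_open pM.
have N0 : 0 < 1 + `|N| by rewrite ltr_pwDl.
exists (r / 2 / (1 + `|N|)); first by rewrite !divr_gt0.
apply: pr; first exact: symmetricD pM.1 (symmetricZ _ sN).
rewrite addrAC subrr add0r normrZ gtr0_norm ?divr_gt0//.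
rewrite mulrAC ltr_pdivrMr//; have := normr_ge0 N; nra.
Qed.

(** [t] ranges over all reals, since prolonging a segment beyond its end uses a negative weight. *)
Definition affine_fun {R : realType} {V : lmodType R} (f : V -> R) : Prop :=
  forall t x y, f (t *: x + (1 - t) *: y) = t * f x + (1 - t) * f y.

Definition convex_set {R : realType} {V : lmodType R} (Q : set V) : Prop :=
  forall t x y, 0 <= t <= 1 -> Q x -> Q y -> Q (t *: x + (1 - t) *: y).

(* Every segment of [Q] ending at [x0] can be prolonged inside [Q] beyond [x0]. *)
Definition core_point {R : realType} {V : lmodType R} (Q : set V) (x0 : V) :=
  Q x0 /\ forall x, Q x -> exists2 d, 0 < d & Q (- d *: x + (1 - - d) *: x0).

(* The multiplier is any slope between those of the chords to the two sides of
   [g = 0]. *)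
Lemma lagrange_multiplier1 {R : realType} {V : lmodType R} {Q : set V}
    {f g : V -> R} {v : R} {x0 : V} :
  convex_set Q -> affine_fun f -> affine_fun g -> core_point Q x0 -> g x0 = 0 ->
  (forall x, Q x -> g x = 0 -> v <= f x) ->
  exists u, forall x, Q x -> v <= f x + u * g x.
Proof.
move=> cQ af ag [Qx0 core] g0 vf.
have [[x1 [Qx1 g1]]|noneg] := pselect (exists x, Q x /\ g x != 0); last first.
  exists 0 => x Qx; rewrite mul0r addr0; apply: vf => //.
  by apply: contrapT => /eqP gx; apply: noneg; exists x.
(* Passing from [x] beyond [x0] reverses the sign of [g], so [g] takes both signs on [Q] as soon as
   it is not identically zero there. *)
have flip x : Q x -> exists d, [/\ 0 < d, Q (- d *: x + (1 - - d) *: x0) &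
    g (- d *: x + (1 - - d) *: x0) = - d * g x].
  move=> /core[d d0 Qd]; exists d; split=> //.
  by rewrite ag g0 mulr0 addr0.
have pos : exists x, Q x /\ 0 < g x.
  have [gp|gn|/eqP] := ltgtP 0 (g x1); [by exists x1| |by rewrite eq_sym (negbTE g1)].
  have [d [d0 Qd gd]] := flip _ Qx1; exists (- d *: x1 + (1 - - d) *: x0).
  by split=> //; rewrite gd; nra.
have neg : exists x, Q x /\ g x < 0.
  have [gp|gn|/eqP] := ltgtP 0 (g x1); [|by exists x1|by rewrite eq_sym (negbTE g1)].
  have [d [d0 Qd gd]] := flip _ Qx1; exists (- d *: x1 + (1 - - d) *: x0).
  by split=> //; rewrite gd; nra.
have slopes x y : Q x -> Q y -> 0 < g x -> g y < 0 ->
    (v - f x) / g x <= (f y - v) / - g y.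
  (* The weight at which the segment from [y] to [x] crosses [g = 0]. *)
  move=> Qx Qy gx gy; pose t := - g y / (g x - g y).
  have den : 0 < g x - g y by lra.
  have t01 : 0 <= t <= 1.
    by rewrite /t divr_ge0 ?(ltW den)//= ?ler_pdivrMr//; lra.
  have := vf _ (cQ t _ _ t01 Qx Qy); rewrite ag af.
  have -> : t * g x + (1 - t) * g y = 0 by rewrite /t; field; rewrite gt_eqF.
  move=> /(_ erefl).
  have -> : t * f x + (1 - t) * f y = (g x * f y - g y * f x) / (g x - g y).
    by rewrite /t; field; rewrite gt_eqF.
  rewrite ler_pdivlMr// => h.
  by rewrite ler_pdivrMr// mulrAC ler_pdivlMr; [nra|lra].
pose L := [set (v - f x) / g x | x in [set x | Q x /\ 0 < g x]].
have ubL y : Q y -> g y < 0 -> ubound L ((f y - v) / - g y).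
  by move=> Qy gy _ [x [Qx gx] <-]; exact: slopes.
have [xp [Qxp gxp]] := pos; have [xn [Qxn gxn]] := neg.
have L0 : L !=set0 by exists ((v - f xp) / g xp), xp.
exists (sup L) => x Qx; have [gx|gx|gx] := ltgtP (g x) 0; last first.
- by rewrite gx mulr0 addr0; exact: vf.
- have : (v - f x) / g x <= sup L.
    apply: sup_upper_bound; last by exists x.
    by split=> //; exists ((f xn - v) / - g xn); exact: ubL.
  rewrite ler_pdivrMr//; lra.
- have : sup L <= (f x - v) / - g x by apply: ge_sup => //; exact: ubL.
  by rewrite ler_pdivlMr; lra.
Qed.

(** Induction on the number of constraints: the slice of [Q] where the first one vanishes is again
    convex with core point [x0] and provides the other multipliers. Adding these to [f] leaves a
    problem with one constraint on all of [Q]. *)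
Lemma lagrange_multipliers {R : realType} {V : lmodType R} {m : nat} {Q : set V}
    {f : V -> R} {g : 'I_m -> V -> R} {v : R} {x0 : V} :
  convex_set Q -> affine_fun f -> (forall i, affine_fun (g i)) ->
  core_point Q x0 -> (forall i, g i x0 = 0) ->
  (forall x, Q x -> (forall i, g i x = 0) -> v <= f x) ->
  exists u : 'I_m -> R, forall x, Q x -> v <= f x + \sum_i u i * g i x.
Proof.
elim: m Q g => [|m IH] Q g cQ af ag [Qx0 core] g0 vf.
  exists (fun=> 0) => x Qx; rewrite big_ord0 addr0; apply: vf => // -[] //.
pose Q' := [set x | Q x /\ g ord0 x = 0].
have [||||//||u hu] := IH Q' (fun i => g (lift ord0 i)).
- move=> t x y t01 [Qx gx] [Qy gy]; split; first exact: cQ.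
  by rewrite ag gx gy !mulr0 addr0.
- by [].
- by move=> i; exact: ag.
- split=> // x [Qx gx]; have [d d0 Qd] := core _ Qx; exists d => //; split=> //.
  by rewrite ag gx g0 !mulr0 addr0.
- move=> x [Qx gx] h; apply: vf => // i.
  by case: (unliftP ord0 i) => [j|] ->.
have [||w hw] := lagrange_multiplier1
    (f := fun x => f x + \sum_i u i * g (lift ord0 i) x)
    (v := v) cQ _ (ag ord0) (conj Qx0 core) (g0 ord0).
- move=> t x y; rewrite af !mulrDr addrACA; congr (_ + _).
  rewrite !mulr_sumr -big_split; apply: eq_bigr => i _ /=; rewrite ag; ring.
- by move=> x Qx gx; exact: hu.
exists (fun i => if unlift ord0 i is Some j then u j else w) => x Qx.
rewrite big_ord_recl unlift_none (addrC (w * _)) addrA.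
by under eq_bigr do rewrite liftK; exact: hw.
Qed.

(** * Ranks and strong duality *)

(** In [M = col_base M *m row_base M] the right factor has a right inverse, so [M] and [col_base M]
    have the same image, and [col_base M] is injective. *)
Lemma dim_column_space {R : realType} {n : nat} (M : 'M[R]_n) :
  \dim (column_space M) = \rank M.
Proof.
pose g := linfun (mulmx (col_base M) : 'cV[R]_(\rank M) -> 'cV[R]_n).
have colE : col_base M = M *m pinvmx (row_base M).
  have /(congr1 (mulmx^~ (pinvmx (row_base M)))) /= := mulmx_base M.
  by rewrite -mulmxA mulmxVp ?row_base_free// mulmx1.
have -> : column_space M = limg g.
  apply: subv_anti; apply/andP; split; apply/subvP => _ /memv_imgP[x _ ->].
    have -> : linfun (mulmx M : 'cV[R]_n -> 'cV[R]_n) x = g (row_base M *m x).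
      by rewrite !lfunE /= mulmxA mulmx_base.
    exact: memv_img (memvf _).
  have -> : g x = linfun (mulmx M : 'cV[R]_n -> 'cV[R]_n)
      (pinvmx (row_base M) *m x).
    by rewrite !lfunE /= mulmxA -colE.
  exact: memv_img (memvf _).
rewrite limg_dim_eq.
  by rewrite dimvf dim_matrix; exact: muln1.
apply/eqP; rewrite capfv; apply/lker0P => x y; rewrite !lfunE /= => xy.
have inv (z : 'cV[R]_(\rank M)) : pinvmx (col_base M) *m (col_base M *m z) = z.
  by rewrite mulmxA mulVpmx ?col_base_full// mul1mx.
by rewrite -(inv x) xy inv.
Qed.

Lemma pd_rank {R : realType} {n : nat} {M : 'M[R]_n} : pd M -> \rank M = n.
Proof.
move=> [sM pM]; apply/eqP; rewrite -/(row_free M) -kermx_eq0.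
apply/eqP/row_matrixP => i; rewrite row0.
have : row i (kermx M) *m M = 0 by apply/sub_kermxP; exact: row_sub.
move: (row _ _) => u uM; apply/eqP; rewrite -trmx_eq0; apply/negP => /negP /pM.
by rewrite trmxK uM mul0mx mxE ltxx.
Qed.

Lemma pd_add_rank {R : realType} {n : nat} {M N : 'M[R]_n} : pd (M + N) ->
  (n <= \rank M + \rank N)%N.
Proof. by move=> h; rewrite -[leqLHS](pd_rank h); exact: mxrank_add. Qed.

(** A zero product bounds the sum of the ranks above by [n]; the invertible sum bounds it below. *)
Lemma complementary_rank {R : realType} {n : nat} {M N : 'M[R]_n} :
  M *m N = 0 -> pd (M + N) -> (\rank M + \rank N = n)%N.
Proof.
move=> MN pMN; apply/eqP; rewrite eqn_leq (pd_add_rank pMN) andbT.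
exact: mulmx0_rank_max.
Qed.

Lemma symmetric_mul0 {R : realType} {n : nat} {M N : 'M[R]_n} :
  Defs.symmetric M -> Defs.symmetric N -> M *m N = 0 -> N *m M = 0.
Proof. by move=> sM sN MN; rewrite -sM -sN -trmx_mul MN trmx0. Qed.

(** Write [x = M *m z + N *m z] and [w = M *m z]. Since [N *m w = 0], the form of [M] at [x] equals
    that of [M + N] at [w]. *)
Lemma psd_of_complementary {R : realType} {n : nat} {M N : 'M[R]_n} :
  Defs.symmetric M -> Defs.symmetric N -> M *m N = 0 -> pd (M + N) -> psd M.
Proof.
move=> sM sN MN pMN; split=> // x.
have NM := symmetric_mul0 sM sN MN.
have uMN : M + N \in unitmx by rewrite -row_free_unit /row_free pd_rank.
pose z := invmx (M + N) *m x.
have xz : x = M *m z + N *m z by rewrite -mulmxDl mulKVmx.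
have Mx : M *m x = M *m (M *m z) by rewrite xz mulmxDr (mulmxA M N) MN mul0mx addr0.
pose w := M *m z.
rewrite -/(bform M x x) bform_mulmxr Mx -bform_mulmxr (bformC _ _ sM).
rewrite bform_mulmxr Mx -bform_mulmxr -/w.
have := (pd_psd pMN).2 w; rewrite -/(bform _ _ _) bform_addmx.
by rewrite (bform_mulmxr N) /w (mulmxA N) NM mul0mx /bform mulmx0 [X in _ + X]mxE addr0.
Qed.

Lemma mxinner_addl {R : realType} {n : nat} (M N L : 'M[R]_n) :
  mxinner (M + N) L = mxinner M L + mxinner N L.
Proof. by rewrite /mxinner mulmxDl mxtraceD. Qed.

Lemma mxinner_scalel {R : realType} {n : nat} a (M L : 'M[R]_n) :
  mxinner (a *: M) L = a * mxinner M L.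
Proof. by rewrite /mxinner -scalemxAl mxtraceZ. Qed.

Lemma mxinner_addr {R : realType} {n : nat} (M N L : 'M[R]_n) :
  mxinner L (M + N) = mxinner L M + mxinner L N.
Proof. by rewrite !(mxinnerC L) mxinner_addl. Qed.

Lemma mxinner_scaler {R : realType} {n : nat} a (M L : 'M[R]_n) :
  mxinner L (a *: M) = a * mxinner L M.
Proof. by rewrite !(mxinnerC L) mxinner_scalel. Qed.

Lemma mxinner_suml {R : realType} {n : nat} (I : finType) (M : 'M[R]_n) F :
  mxinner (\sum_(i : I) F i) M = \sum_i mxinner (F i) M.
Proof. by rewrite mxinnerC mxinner_sumr; apply: eq_bigr => i _; exact: mxinnerC. Qed.

Lemma cost_at_symmetric {R : realType} {n m : nat} {P : parametric_sdp R n m} e :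
  standing_assumptions P -> Defs.symmetric (cost_at P e).
Proof. by move=> [[sC sC' _] _ _]; exact: symmetricD sC (symmetricZ _ sC'). Qed.

Lemma psd_core_point {R : realType} {n : nat} {M : 'M[R]_n} :
  pd M -> core_point [set Z : 'M[R]_n | psd Z] M.
Proof.
move=> pM; split=> [|Z [sZ pZ]]; first exact: pd_psd.
have [d d0 pd] := pd_add_small pM (symmetricD pM.1 (symmetricZ (-1) sZ)).
exists d => //; suff -> : - d *: Z + (1 - - d) *: M = M + d *: (M + -1 *: Z).
  exact: pd_psd.
by rewrite opprK scalerDl scale1r scalerDr scalerA mulrN1 addrC addrA.
Qed.

(** Lagrange multipliers over the positive semidefinite cone, with the Slater point as core point,
    give [y] up to sign; [S] is the resulting slack. *)
Lemma dual_multiplier {R : realType} {n m : nat} {P : parametric_sdp R n m} {e X} :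
  standing_assumptions P -> primal_optimal P e X ->
  exists y S, dual_feasible P e (y, S) /\ mxinner (cost_at P e) X <= dual_obj P y.
Proof.
move=> hP [[AX pX] optX].
have [[_ _ sA] _ [X0 [_ [_ [[AX0 _] _ pX0 _]]]]] := hP.
have [||||||u hu] := lagrange_multipliers (Q := [set Z : 'M[R]_n | psd Z])
  (f := mxinner (cost_at P e)) (g := fun i Z => mxinner (constr P i) Z - rhs P i 0)
  (v := mxinner (cost_at P e) X) (x0 := X0).
- move=> t Z W /andP[t0 t1] pZ pW; apply: psdD; apply: psdZ => //.
  by rewrite subr_ge0.
- by move=> t Z W; rewrite mxinner_addr !mxinner_scaler.
- by move=> i t Z W; rewrite mxinner_addr !mxinner_scaler; ring.
- exact: psd_core_point.
- by move=> i; rewrite AX0 subrr.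
- move=> Z pZ AZ; apply: optX; split=> // i.
  by apply/eqP; rewrite -subr_eq0; apply/eqP; exact: AZ.
pose S := cost_at P e + \sum_i u i *: constr P i.
have SE Z : psd Z -> mxinner (cost_at P e) X <=
    mxinner S Z - \sum_i u i * rhs P i 0.
  move=> pZ; apply: le_trans (hu Z pZ) _; rewrite le_eqVlt; apply/orP; left.
  apply/eqP; rewrite [mxinner S _]mxinner_addl mxinner_suml -addrA; congr (_ + _).
  rewrite -sumrN -big_split; apply: eq_bigr => i _ /=.
  by rewrite mxinner_scalel mulrBr.
exists (\col_i - u i), S; split; last first.
  (* At [Z = 0] the Lagrangian bound is the inequality between the objectives. *)
  have := SE 0; rewrite /mxinner mulmx0 mxtrace0 add0r => h.
  have -> : dual_obj P (\col_i - u i) = - \sum_i u i * rhs P i 0.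
    by rewrite -sumrN; apply: eq_bigr => i _; rewrite mxE mulrN mulrC.
  by apply: h; rewrite -(mulmx0 _ (0 : 'cV_n)) -[X in _ *m X]trmx0; exact: psd_rank1.
split=> /=.
  rewrite addrCA -big_split big1 ?addr0// => i _ /=.
  by rewrite mxE scaleNr addNr.
split=> [|x].
  apply: symmetricD; first exact: cost_at_symmetric.
  by apply: symmetric_sum => i; exact: symmetricZ.
rewrite -/(bform S x x) leNgt; apply/negP => neg.
pose c := mxinner (cost_at P e) X + \sum_i u i * rhs P i 0.
(* The bound along the ray [t *: (x *m x^T)]; a negative slope [bform S x x] would violate it for
   large [t]. *)
have h t : 0 <= t -> c <= t * bform S x x.
  move=> t0; have := SE _ (psdZ _ t0 (psd_rank1 x)).
  by rewrite mxinner_scaler mxinner_rank1 lerBrDr.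
have := h ((`|c| + 1) / - bform S x x).
rewrite divr_ge0 ?addr_ge0 ?oppr_ge0 ?(ltW neg)// => /(_ isT).
have -> : (`|c| + 1) / - bform S x x * bform S x x = - (`|c| + 1).
  by field; rewrite lt_eqF.
have := ler_norm (- c); rewrite normrN; lra.
Qed.

Lemma mxinner_dual_obj {R : realType} {n m : nat} {P : parametric_sdp R n m}
    {e} {y : 'cV[R]_m} {S X} :
  (forall i, mxinner (constr P i) X = rhs P i 0) ->
  (\sum_(i < m) y i 0 *: constr P i) + S = cost_at P e ->
  mxinner (cost_at P e) X = dual_obj P y + mxinner S X.
Proof.
move=> AX <-; rewrite mxinner_addl mxinner_suml; congr (_ + _).
by apply: eq_bigr => i _; rewrite mxinner_scalel AX mulrC.
Qed.

(** The duality gap is [mxinner S X]. It is nonnegative, and [dual_multiplier] makes it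
    nonpositive. *)
Lemma optimal_complementary {R : realType} {n m : nat}
    {P : parametric_sdp R n m} {e X y S} :
  standing_assumptions P -> primal_optimal P e X -> dual_optimal P e (y, S) ->
  X *m S = 0.
Proof.
move=> hP oX [[/= CE pS] oyS].
have [y' [S' [dS' le']]] := dual_multiplier hP oX.
apply: mxinner_eq0 => //; first exact: oX.1.2.
apply/eqP; rewrite eq_le mxinner_ge0 ?andbT//; last exact: oX.1.2.
have := le_trans le' (oyS _ dS').
rewrite (mxinner_dual_obj oX.1.1 CE) mxinnerC.
by rewrite gerDl.
Qed.

(** * Relative interiors of the optimal sets *)

(** The linear constraints, symmetry and [X' *m S = 0] pass to the affine hull. Near [X] the sum
    [X' + S] stays positive definite, so [psd_of_complementary] gives feasibility, and [X' *m S = 0]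
    gives optimality. *)
Lemma primal_relint_of_strict {R : realType} {n m : nat}
    {P : parametric_sdp R n m} {e X y S} :
  standing_assumptions P -> strictly_complementary P e X y S ->
  primal_relint (primal_optimal P e) X.
Proof.
move=> hP [oX oS pXS]; split=> //; have [r r0 open] := pd_open pXS.
apply/nbhs_normP; exists r => //= X' XX' [k [t [a [oa t1 X'E]]]].
have AX' i : mxinner (constr P i) X' = rhs P i 0.
  rewrite X'E mxinner_sumr -[RHS]mul1r -t1 mulr_suml.
  by apply: eq_bigr => j _; rewrite mxinner_scaler (oa j).1.1.
have sX' : Defs.symmetric X'.
  by rewrite X'E; apply: symmetric_sum => j; apply/symmetricZ; exact: (oa j).1.2.1.
have X'S : X' *m S = 0.
  rewrite X'E mulmx_suml big1// => j _.
  by rewrite -scalemxAl (optimal_complementary hP (oa j) oS) scaler0.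
have sS := oS.1.2.1.
have pX' : psd X'.
  apply: (psd_of_complementary sX' sS X'S); apply: open; first exact: symmetricD.
  by rewrite opprD addrACA subrr addr0 distrC.
split=> // Z fZ; apply: le_trans (oX.2 _ fZ); have CE := oS.1.1.
rewrite (mxinner_dual_obj AX' CE) (mxinner_dual_obj oX.1.1 CE) /mxinner /=.
rewrite (symmetric_mul0 sX' sS X'S).
by rewrite (symmetric_mul0 oX.1.2.1 sS (optimal_complementary hP oX oS)).
Qed.

(** The same argument with the roles of [X] and [S] exchanged. *)
Lemma dual_relint_of_strict {R : realType} {n m : nat}
    {P : parametric_sdp R n m} {e X y S} :
  standing_assumptions P -> strictly_complementary P e X y S ->
  dual_relint (dual_optimal P e) (y, S).
Proof.
move=> hP [oX oS pXS]; split=> //; have [r r0 open] := pd_open pXS.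
apply/nbhs_normP; exists r => //= -[y' S'] XX' [k [t [a [oa t1 X'E]]]].
have y'E : y' = \sum_j t j *: (a j).1.
  by move/(congr1 fst): X'E; rewrite raddf_sum.
have S'E : S' = \sum_j t j *: (a j).2.
  by move/(congr1 snd): X'E; rewrite raddf_sum.
have CE' : (\sum_(i < m) y' i 0 *: constr P i) + S' = cost_at P e.
  rewrite -[RHS]scale1r -t1 scaler_suml S'E.
  transitivity (\sum_j t j *: (\sum_(i < m) (a j).1 i 0 *: constr P i + (a j).2)).
    under [RHS]eq_bigr do rewrite scalerDr scaler_sumr.
    rewrite big_split; congr (_ + _); rewrite exchange_big; apply: eq_bigr => i _.
    by rewrite y'E summxE scaler_suml; apply: eq_bigr => j _; rewrite mxE scalerA.
  by apply: eq_bigr => j _; rewrite (oa j).1.1.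
have sS' : Defs.symmetric S'.
  by rewrite S'E; apply: symmetric_sum => j; apply/symmetricZ; exact: (oa j).1.2.1.
have XS' : X *m S' = 0.
  rewrite S'E mulmx_sumr big1// => j _; rewrite -scalemxAr.
  move: (oa j); case: (a j) => y'' S'' oS''.
  by rewrite (optimal_complementary hP oX oS'') scaler0.
have sX := oX.1.2.1.
have S'X := symmetric_mul0 sX sS' XS'.
have pS' : psd S'.
  apply: (psd_of_complementary sS' sX S'X); rewrite addrC.
  apply: open; first exact: symmetricD.
  rewrite opprD addrACA subrr add0r distrC; apply: le_lt_trans XX'.
  (* The norm on pairs is the maximum, so it dominates the norm of the matrix component. *)
  by rewrite [leRHS]/Num.norm /= le_max lexx orbT.
split=> // yS'' fS''; apply: le_trans (oS.2 _ fS'') _ => /=.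
have := mxinner_dual_obj oX.1.1 CE'.
rewrite (mxinner_dual_obj oX.1.1 oS.1.1) /mxinner /=.
rewrite S'X (symmetric_mul0 sX oS.1.2.1 (optimal_complementary hP oX oS)).
by rewrite !mxtrace0 !addr0 => ->.
Qed.

Lemma maximal_of_strict {R : realType} {n m : nat}
    {P : parametric_sdp R n m} {e X y S} :
  standing_assumptions P -> strictly_complementary P e X y S ->
  maximally_complementary P e X y S.
Proof.
move=> hP h; split; first exact: primal_relint_of_strict h.
exact: dual_relint_of_strict h.
Qed.

(** The prolonged point is the affine combination of [x] and [y] with weights [1 + t] and [- t], and
    it is close to [x] for small [t]. *)
Lemma relint_extend {R : realType} {V : normedModType R} {A : set V} {x y : V} :
  A y -> A x -> (\forall z \near x, affine_hull A z -> A z) ->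
  exists2 t, 0 < t & A (x + t *: (x - y)).
Proof.
move=> Ay Ax /nbhs_normP[r /= r0 hr].
have N0 : 0 < 1 + `|x - y| by rewrite ltr_pwDl.
pose t := r / 2 / (1 + `|x - y|).
have t0 : 0 < t by rewrite !divr_gt0.
exists t => //; apply: hr.
  rewrite /ball_ /= opprD addrA subrr add0r normrN normrZ gtr0_norm//.
  rewrite /t mulrAC ltr_pdivrMr//; have := normr_ge0 (x - y); nra.
exists 2%N, (fun i => if i == ord0 then 1 + t else - t).
exists (fun i => if i == ord0 then x else y); split.
- by move=> i; case: ifP.
- by rewrite !big_ord_recl big_ord0 /=; ring.
- rewrite !big_ord_recl big_ord0 /= addr0 scalerDl scale1r scalerBr scaleNr.
  by rewrite addrA.
Qed.

(* [L] vanishes only where [M] does, since [L] minus a multiple of [M] stays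
   nonnegative there. *)
Lemma pd_of_extend {R : realType} {n : nat} {M N L : 'M[R]_n} t :
  pd (M + N) -> psd L -> psd N -> 0 < t -> psd (L + t *: (L - M)) ->
  pd (L + N).
Proof.
move=> [_ pMN] pL pN t0 [_ h]; split; first exact: symmetricD pL.1 pN.1.
move=> x x0; have := pMN x x0; have := h x; have := pL.2 x; have := pN.2 x.
rewrite -!/(bform _ _ _) !bform_addmx bform_scalemx bform_addmx.
rewrite -scaleN1r bform_scalemx => Nx Lx hx MNx.
rewrite lt_def addr_ge0// andbT; apply/eqP => LN0.
have Lx0 : bform L x x = 0 by lra.
by move: hx; rewrite Lx0; nra.
Qed.

(** Prolonging [X'] away from [X], and [S'] away from [S], shows that the mixed pairs [(X', S)] and
    [(X, S')] are strictly complementary too; all these rank sums equal [n]. *)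
Lemma partition_dims_of_strict {R : realType} {n m : nat}
    {P : parametric_sdp R n m} {e X y S p} :
  standing_assumptions P -> strictly_complementary P e X y S ->
  is_optimal_partition P e p ->
  \dim (part_B p) = \rank X /\ \dim (part_N p) = \rank S.
Proof.
move=> hP [oX oS pXS] [X' [y' [S' [[[oX' riX'] [oS' riS']] ->]]]] /=.
rewrite !dim_column_space.
have [t t0 oXt] := relint_extend oX oX' riX'.
have [u u0 oSu] := relint_extend oS oS' riS'.
have pX'S : pd (X' + S).
  exact: pd_of_extend pXS oX'.1.2 oS.1.2 t0 oXt.1.2.
have pS'X : pd (S' + X).
  apply: (pd_of_extend _ _ oS'.1.2 oX.1.2 u0 oSu.1.2).
  by rewrite addrC.
rewrite addrC in pS'X.
have r0 := complementary_rank (optimal_complementary hP oX oS) pXS.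
have r1 := complementary_rank (optimal_complementary hP oX' oS) pX'S.
have r2 := complementary_rank (optimal_complementary hP oX oS') pS'X.
split; first by apply/eqP; rewrite -(eqn_add2r (\rank S)) r1 r0.
by apply/eqP; rewrite -(eqn_add2l (\rank X)) r2 r0.
Qed.

(** * Constancy of the dimensions *)

Lemma pd_cvg_near {R : realType} {n : nat} {M : nat -> 'M[R]_n} {L : 'M[R]_n} :
  (forall k, Defs.symmetric (M k)) -> M @ \oo --> L -> pd L ->
  \forall k \near \oo, pd (M k).
Proof.
move=> sM ML /pd_open[r r0 open].
move/cvgrPdist_lt : ML => /(_ r r0); apply: filterS => k h.
by apply: open => //; rewrite distrC.
Qed.

(** The limit supplied by the hypothesis may depend on the sequence; its ranks do not. *)
Lemma strict_rank_unique {R : realType} {n m : nat} {P : parametric_sdp R n m}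
    {e X y S X' y' S'} :
  standing_assumptions P -> strictly_complementary P e X y S ->
  strictly_complementary P e X' y' S' -> \rank X = \rank X' /\ \rank S = \rank S'.
Proof.
move=> hP h h'.
have [] := @partition_dims_of_strict _ _ _ _ _ _ _ _ (partition_of X S) hP h'.
  by exists X, y, S; split=> //; exact: maximal_of_strict.
by rewrite /= !dim_column_space.
Qed.

Lemma strict_near {R : realType} {n m : nat} {P : parametric_sdp R n m} {ebar : R}
    {e : nat -> R} {X : nat -> 'M[R]_n} {y : nat -> 'cV[R]_m} {S : nat -> 'M[R]_n}
    {Xs ys Ss} :
  standing_assumptions P ->
  (forall k, primal_optimal P (e k) (X k) /\ dual_optimal P (e k) (y k, S k)) ->
  X @ \oo --> Xs -> S @ \oo --> Ss -> strictly_complementary P ebar Xs ys Ss ->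
  \forall k \near \oo, [/\ strictly_complementary P (e k) (X k) (y k) (S k),
    \rank (X k) = \rank Xs & \rank (S k) = \rank Ss].
Proof.
move=> hP opt cX cS [oXs oSs pXS].
have sX k : Defs.symmetric (X k) := (opt k).1.1.2.1.
have sS k : Defs.symmetric (S k) := (opt k).2.1.2.1.
have r0 := complementary_rank (optimal_complementary hP oXs oSs) pXS.
near=> k.
have pk : pd (X k + S k).
  near: k; apply: (@pd_cvg_near _ _ (fun k => X k + S k) _ _ _ pXS) => [k|].
    exact: symmetricD.
  exact: cvgD.
have pX : pd (X k + Ss).
  near: k; apply: (@pd_cvg_near _ _ (fun k => X k + Ss) _ _ _ pXS) => [k|].
    exact: symmetricD (sX k) oSs.1.2.1.
  by apply: cvgD => //; exact: cvg_cst.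
have pS : pd (Xs + S k).
  near: k; apply: (@pd_cvg_near _ _ (fun k => Xs + S k) _ _ _ pXS) => [k|].
    exact: symmetricD oXs.1.2.1 (sS k).
  by apply: cvgD => //; exact: cvg_cst.
have [oX oS] := opt k.
have rk := complementary_rank (optimal_complementary hP oX oS) pk.
have rX := pd_add_rank pX; have rS := pd_add_rank pS.
by split=> //; lia.
Unshelve. all: by end_near. Qed.

(** Passage from sequences to a neighbourhood: if it failed, parameters violating the claim could be
    chosen within [k.+1%:R^-1] of [ebar], and the hypothesis on this sequence refutes one of
    them. *)
Lemma constant_dims_near {R : realType} {n m : nat} {P : parametric_sdp R n m}
    {ebar : R} {r s : nat} :
  standing_assumptions P -> (bounded_params P)° ebar ->
  (forall e : nat -> R, (forall k, (bounded_params P)° (e k)) ->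
    e @ \oo --> ebar ->
    exists X y S, \forall k \near \oo,
      [/\ strictly_complementary P (e k) (X k) (y k) (S k),
          \rank (X k) = r & \rank (S k) = s]) ->
  \forall e \near ebar, (bounded_params P)° e /\
    forall p, is_optimal_partition P e p ->
      \dim (part_B p) = r /\ \dim (part_N p) = s.
Proof.
move=> hP hebar hseq; pose G e := (bounded_params P)° e /\
    forall p, is_optimal_partition P e p ->
      \dim (part_B p) = r /\ \dim (part_N p) = s.
rewrite -/(G _); apply: contrapT => nG.
have /nbhs_ballP[d /= d0 dE] : nbhs ebar (bounded_params P)°.
  by apply: open_nbhs_nbhs; split=> //; exact: open_interior.
have /choice[e eP] : forall k : nat, exists e,
    [/\ (bounded_params P)° e, `|ebar - e| < k.+1%:R^-1 & ~ G e].
  move=> k; apply: contrapT => h; apply: nG.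
  (* The minimum with [d] keeps the ball inside the interior of [bounded_params P]. *)
  apply/nbhs_ballP; exists (Num.min d k.+1%:R^-1) => /=.
    by rewrite lt_min d0 invr_gt0 ltr0Sn.
  move=> e; rewrite /ball /= lt_min => /andP[ed ek].
  by apply: contrapT => nGe; apply: h; exists e; split=> //; exact: dE.
have [k||X [y [S near_strict]]] := hseq e; first by have [] := eP k.
  apply/cvgrPdist_lt => t t0.
  near=> k; have [_ h _] := eP k; apply: lt_trans h _.
  by near: k; exact: (near_infty_natSinv_lt (PosNum t0)).
have [k [sk rk sk']] := filter_ex near_strict.
have [ek _] := eP k; apply; split=> // p op.
by rewrite -rk -sk'; exact: partition_dims_of_strict sk op.
Unshelve. all: by end_near. Qed.

(* Two admissible intervals through [e] overlap around [e], and the optimal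
   partition at [e] ties their dimensions together. *)
Lemma maximal_interval_exists {R : realType} {n m : nat}
    {P : parametric_sdp R n m} {J : set R} {e : R} {p} :
  constant_dims_interval P J -> J e -> is_optimal_partition P e p ->
  exists I, maximal_constant_dims_interval P I /\ I e.
Proof.
move=> cJ Je op.
pose I := \bigcup_(K in [set K | constant_dims_interval P K /\ K e]) K.
have JI : J `<=` I by move=> x Jx; exists J.
have [oJ iJ [e1 [e2 [Je1 Je2 e12]]] JE dJ] := cJ.
exists I; split; last exact: JI; split.
  split.
  - by apply: bigcup_open => K [[]].
  - move=> x y [K [cK Ke] Kx] [L [cL Le] Ly] z /andP[xz zy].
    have [_ iK _ _ _] := cK; have [_ iL _ _ _] := cL.
    (* The point [z] lies between [e] and one of the two ends, hence in the interval that contains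
       that end. *)
    have [ez|/ltW ze] := leP e z.
      by exists L => //; apply: (iL e y) => //; rewrite ez zy.
    by exists K => //; apply: (iK x e) => //; rewrite xz ze.
  - by exists e1, e2; split=> //; exact: JI.
  - by move=> x [K [[_ _ _ KE _] _] Kx]; exact: KE.
  - move=> x y p1 p2 [K [[_ _ _ _ dK] Ke] Kx] [L [[_ _ _ _ dL] Le] Ly] o1 o2.
    have [-> ->] := dK x e p1 p Kx Ke o1 op.
    by have [-> ->] := dL y e p2 p Ly Le o2 op.
move=> K cK IK; apply/seteqP; split=> // x Kx; exists K => //; split=> //.
exact/IK/JI.
Qed.

Theorem theorem3p6 (R : realType) (n m : nat) (P : parametric_sdp R n m)
    (hP : standing_assumptions P)
    (ebar : R) (hebar : (bounded_params P)° ebar)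
    (hseq : forall e : nat -> R,
        (forall k, (bounded_params P)° (e k)) ->
        e @ \oo --> ebar ->
        exists (X : nat -> 'M[R]_n) (y : nat -> 'cV[R]_m) (S : nat -> 'M[R]_n)
               (Xs : 'M[R]_n) (ys : 'cV[R]_m) (Ss : 'M[R]_n),
          [/\ (forall k, primal_optimal P (e k) (X k) /\
                         dual_optimal P (e k) (y k, S k)),
              X @ \oo --> Xs, y @ \oo --> ys, S @ \oo --> Ss &
              strictly_complementary P ebar Xs ys Ss])
    (hvar : ~ exists I : set R, constant_partition_interval P I /\ I ebar) :
  exists I : set R, nonlinearity_interval P I /\ I ebar.
Proof.
(* The constant sequence yields a strictly complementary solution at [ebar], whose ranks serve as
   reference values. *)
have [||_ [_ [_ [X0 [y0 [S0 [_ _ _ _ strict0]]]]]]] := hseq (fun=> ebar).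
- by [].
- exact: cvg_cst.
have near_dims : \forall e \near ebar, (bounded_params P)° e /\
    forall p, is_optimal_partition P e p ->
      \dim (part_B p) = \rank X0 /\ \dim (part_N p) = \rank S0.
  apply: constant_dims_near => // e eE /(hseq e eE).
  move=> [X [y [S [Xs [ys [Ss [opt cX _ cS strict]]]]]]]; exists X, y, S.
  have [-> ->] := strict_rank_unique hP strict0 strict.
  exact: strict_near hP opt cX cS strict.
have /nbhs_ballP[d /= d0 dP] := near_dims.
have cB : constant_dims_interval P (ball ebar d).
  split.
  - exact: ball_open.
  - move=> x y; rewrite /ball /= => bx by_ z /andP[xz zy].
    move: bx by_; rewrite !ltr_norml => /andP[? ?] /andP[? ?].
    by apply/andP; split; lra.
  - exists ebar, (ebar + d / 2); split; first exact: ballxx.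
      rewrite /ball /= opprD addrA subrr add0r normrN gtr0_norm ?divr_gt0//.
      by rewrite ltr_pdivrMr// mulr_natr mulr2n ltrDl.
    by rewrite lt_eqF// ltrDl divr_gt0.
  - by move=> x /dP[].
  - move=> x y p q /dP[_ hx] /dP[_ hy] /hx[-> ->] /hy[-> ->]; by [].
have op : is_optimal_partition P ebar (partition_of X0 S0).
  by exists X0, y0, S0; split=> //; exact: maximal_of_strict.
have [I [maxI Ie]] := maximal_interval_exists cB (ballxx _ d0) op.
(* Were the partition not to vary on [I], then [I] would be a [constant_partition_interval]
   containing [ebar], which [hvar] excludes. *)
exists I; split=> //; split=> //; apply: contrapT => const; apply: hvar.
by exists I.
Qed.
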